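(* Let $p$ be a prime with $p\equiv1\pmod3$, $\theta\in\mathcal{E}_p$, $q\in\mathbb{Q}_p$ with $0<|\theta-1|_p<|q|_p^2<1$, and $f=f_{\theta,q,3}$. Then: (i) the dynamical system $f:\mathcal{J}_0\to\mathcal{J}_0$ (with the metric induced by $|\cdot|_p$) is isometrically conjugate to the full shift $(\Sigma_3,\sigma,d_f)$ over an alphabet of three symbols; (ii) $\mathbb{Q}_p=\mathfrak{B}(\mathbf{x}^{(0)})\cup\mathcal{J}_0\cup\bigcup_{n=0}^{+\infty}f^{-n}\{\mathbf{x}^{(\infty)}\}$.
   Context: $\mathcal{E}_p=\{x\in\mathbb{Q}_p:|x-1|_p<p^{-1/(p-1)}\}$; $\mathbb{B}_\rho(a)=\{x\in\mathbb{Q}_p:|x-a|_p<\rho\}$. The Potts--Bethe mapping is $f_{\theta,q,3}(x)=\left(\frac{\theta x+q-1}{x+\theta+q-2}\right)^3$, defined on $\mathbb{Q}_p\setminus\{\mathbf{x}^{(\infty)}\}$, $\mathbf{x}^{(\infty)}=2-\theta-q$. For $S\subset\mathbb{Q}_p$, $n\ge0$, $f^{-n}(S)$ is the set of $x$ for which $f^n(x)$ is defined and lies in $S$. The cubic $y^3-(1+\theta+\theta^2)y^2-(2\theta+1)(1-\theta-q)y-(1-\theta-q)^2=0$ has three roots $\mathbf{y}^{(1)},\mathbf{y}^{(2)},\mathbf{y}^{(3)}\in\mathbb{Z}_p$, labelled so that $|\mathbf{y}^{(1)}|_p=1>|\mathbf{y}^{(2)}|_p=|\mathbf{y}^{(3)}|_p=|1-\theta-q|_p$.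 Set $\mathbf{x}^{(0)}=1$, $\mathbf{x}^{(i)}=1-q+(\theta-1)(\mathbf{y}^{(i)}-1)$ for $i=1,2,3$; these are fixed points of $f$. $\mathfrak{B}(\mathbf{x}^{(0)})=\{x\in\mathbb{Q}_p:\lim_{n\to\infty}f^n(x)=\mathbf{x}^{(0)}\}$ (all iterates defined). Let $r=|q|_p|\theta-1|_p$, $\mathbb{X}=\mathbb{B}_r(\mathbf{x}^{(1)})\cup\mathbb{B}_r(\mathbf{x}^{(2)})\cup\mathbb{B}_r(\mathbf{x}^{(3)})$ (a disjoint union), and $\mathcal{J}_0=\bigcap_{n=0}^\infty f^{-n}(\mathbb{X})$. $\Sigma_3$ is the set of one-sided infinite sequences over the alphabet $\{1,2,3\}$ and $\sigma$ the left shift. The metric $d_f$: on $\mathbb{B}_r(\mathbf{x}^{(i)})$ the map $f$ satisfies $|f(x)-f(y)|_p=p^{\tau_i}|x-y|_p$ with $p^{\tau_1}=\frac{|q|_p}{|\theta-1|_p}$ and $p^{\tau_2}=p^{\tau_3}=\frac{1}{|q|_p|\theta-1|_p}$; for $i\ne j$ let $\kappa(i,j)$ be the integer with $|\mathbf{x}^{(i)}-\mathbf{x}^{(j)}|_p=p^{-\kappa(i,j)}$. For distinct $x=(x_0,x_1,\dots)$, $y=(y_0,y_1,\dots)$ in $\Sigma_3$ with $n=\min\{k\ge0:x_k\ne y_k\}$, $d_f(x,y)=p^{-\tau_{x_0}-\cdots-\tau_{x_{n-1}}-\kappa(x_n,y_n)}$ (which is $p^{-\kappa(x_0,y_0)}$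 if $n=0$). Isometrically conjugate means conjugate by a bijective isometry. *)

(* Defs.v *)
From HB Require Import structures.
From mathcomp Require Import all_boot all_order all_algebra.
From mathcomp Require Import zify.
From mathcomp Require Import boolp classical_sets functions reals.
From mathcomp Require Import topology normedtype sequences exp.

Set Implicit Arguments.
Unset Strict Implicit.
Unset Printing Implicit Defensive.

Import Order.TTheory GRing.Theory Num.Theory.
Import numFieldNormedType.Exports.
Local Open Scope ring_scope.
Local Open Scope classical_set_scope.

(** Z_p is the inverse limit of the rings Z/p^n, an element of Z/p^n being
    represented by its remainder in [0, p^n). The compatibility condition
    forces [residue z n] to lie in that range. *)

Record padic_int (p : nat) (p_pr : prime p) := PadicInt {
  residue :> nat -> int;
  _ : forall n, (residue n.+1 %% (p ^ n)%N)%Z = residue n }.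

HB.instance Definition _ (p : nat) (p_pr : prime p) :=
  gen_eqMixin (padic_int p_pr).
HB.instance Definition _ (p : nat) (p_pr : prime p) :=
  gen_choiceMixin (padic_int p_pr).

Section PadicIntRing.
Context (p : nat) (p_pr : prime p).
Implicit Types x y z : padic_int p_pr.

Lemma residueS x n : (x n.+1 %% (p ^ n)%N)%Z = x n.
Proof. by case: x. Qed.

Lemma residue_mod x n : (x n %% (p ^ n)%N)%Z = x n.
Proof. by rewrite -residueS modz_mod. Qed.

Lemma padic_int_ext x y : residue x =1 residue y -> x = y.
Proof.
case: x y => [a Ha] [b Hb] /= /funext eab; move: Ha Hb; rewrite eab => Ha Hb.
by rewrite (Prop_irrelevance Ha Hb).
Qed.

Lemma modz_pow (a : int) (m n : nat) : (m <= n)%N ->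
  ((a %% (p ^ n)%N)%Z %% (p ^ m)%N)%Z = (a %% (p ^ m)%N)%Z.
Proof.
move=> mn; have E : a = (a %/ (p ^ n)%N)%Z * (p ^ (n - m))%N * (p ^ m)%N
    + (a %% (p ^ n)%N)%Z by rewrite -mulrA -PoszM -expnD subnK // -divz_eq.
by rewrite [in RHS]E modzMDl.
Qed.

Lemma residue_le x (m n : nat) :
  (m <= n)%N -> (x n %% (p ^ m)%N)%Z = x m.
Proof.
elim: n => [|n IHn]; first by rewrite leqn0 => /eqP ->; exact: residue_mod.
rewrite leq_eqVlt => /predU1P[->|mn]; first exact: residue_mod.
by rewrite -(@modz_pow _ m n) // residueS IHn.
Qed.

Fact padic_int_of_subproof (a : nat -> int)
    (Ha : forall n, (a n.+1 = a n %[mod (p ^ n)%N])%Z) n :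
  ((a n.+1 %% (p ^ n.+1)%N)%Z %% (p ^ n)%N)%Z = (a n %% (p ^ n)%N)%Z.
Proof. by rewrite modz_pow // Ha. Qed.

Definition padic_int_of a Ha : padic_int p_pr :=
  PadicInt p_pr (@padic_int_of_subproof a Ha).

Fact residue_compat x n : (x n.+1 = x n %[mod (p ^ n)%N])%Z.
Proof. by rewrite residueS residue_mod. Qed.

Fact cst_compat (m : int) n : (m = m %[mod (p ^ n)%N])%Z.
Proof. by []. Qed.

Fact opp_compat x n : (- x n.+1 = - x n %[mod (p ^ n)%N])%Z.
Proof. by rewrite -modzNm residueS. Qed.

Fact add_compat x y n :
  (x n.+1 + y n.+1 = x n + y n %[mod (p ^ n)%N])%Z.
Proof. by rewrite -modzDm !residueS. Qed.

Fact mul_compat x y n :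
  (x n.+1 * y n.+1 = x n * y n %[mod (p ^ n)%N])%Z.
Proof. by rewrite -modzMm !residueS. Qed.

Definition padic_int_cst m := padic_int_of (cst_compat m).
Definition padic_int_opp x := padic_int_of (opp_compat x).
Definition padic_int_add x y := padic_int_of (add_compat x y).
Definition padic_int_mul x y := padic_int_of (mul_compat x y).

Fact padic_int_addA : associative padic_int_add.
Proof.
by move=> x y z; apply: padic_int_ext => n /=; rewrite modzDml modzDmr addrA.
Qed.

Fact padic_int_addC : commutative padic_int_add.
Proof. by move=> x y; apply: padic_int_ext => n /=; rewrite addrC. Qed.

Fact padic_int_add0 : left_id (padic_int_cst 0) padic_int_add.
Proof.
by move=> x; apply: padic_int_ext => n /=; rewrite modzDml add0r residue_mod.
Qed.

Fact padic_int_addN :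
  left_inverse (padic_int_cst 0) padic_int_opp padic_int_add.
Proof.
by move=> x; apply: padic_int_ext => n /=; rewrite modzDml addNr.
Qed.

HB.instance Definition _ := GRing.isZmodule.Build (padic_int p_pr)
  padic_int_addA padic_int_addC padic_int_add0 padic_int_addN.

Fact padic_int_mulA : associative padic_int_mul.
Proof.
by move=> x y z; apply: padic_int_ext => n /=; rewrite modzMml modzMmr mulrA.
Qed.

Fact padic_int_mulC : commutative padic_int_mul.
Proof. by move=> x y; apply: padic_int_ext => n /=; rewrite mulrC. Qed.

Fact padic_int_mul1 : left_id (padic_int_cst 1) padic_int_mul.
Proof.
by move=> x; apply: padic_int_ext => n /=; rewrite modzMml mul1r residue_mod.
Qed.

Fact padic_int_mulDl : left_distributive padic_int_mul padic_int_add.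
Proof.
move=> x y z; apply: padic_int_ext => n /=.
by rewrite modzMml modzDmr modzDml mulrDl.
Qed.

Fact padic_int_oner_neq0 : padic_int_cst 1 != padic_int_cst 0.
Proof.
apply/eqP => /(congr1 (fun z : padic_int p_pr => z 1%N)) /=.
by rewrite expn1 mod0z modz_small // ltz_nat prime_gt1.
Qed.

HB.instance Definition _ := GRing.Zmodule_isComNzRing.Build (padic_int p_pr)
  padic_int_mulA padic_int_mulC padic_int_mul1 padic_int_mulDl
  padic_int_oner_neq0.

Definition padic_int_unit : {pred padic_int p_pr} :=
  [pred x | `[< exists y, y * x = 1 >]].

Definition padic_int_inv x := xget x [set y | y * x = 1].

Fact padic_int_mulV : {in padic_int_unit, left_inverse 1 padic_int_inv *%R}.
Proof.
move=> x /asboolP [y xy]; rewrite /padic_int_inv.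
by case: xgetP => [z _ //|/(_ y)]; case.
Qed.

Fact padic_int_unitP x y : y * x = 1 -> padic_int_unit x.
Proof. by move=> yx; apply/asboolP; exists y. Qed.

Fact padic_int_inv_out : {in [predC padic_int_unit], padic_int_inv =1 id}.
Proof.
move=> x /asboolP xNu; rewrite /padic_int_inv.
by case: xgetP => // z _ zx; case: xNu; exists z.
Qed.

HB.instance Definition _ :=
  GRing.ComNzRing_hasMulInverse.Build (padic_int p_pr)
    padic_int_mulV padic_int_unitP padic_int_inv_out.

Lemma padic_int_neq0P x : x != 0 -> exists n, x n != 0.
Proof.
move=> x0; apply/not_existsP => xn0; move/eqP: x0; apply.
by apply: padic_int_ext => n /=; rewrite mod0z; apply/eqP/negPn/negP/xn0.
Qed.

Lemma dvdn_primeX_mul (m n a b : nat) :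
  (p ^ (m + n).-1 %| a * b -> (p ^ m %| a) || (p ^ n %| b))%N.
Proof.
have [->|a0] := posnP a; first by rewrite dvdn0.
have [->|b0] := posnP b; first by rewrite dvdn0 orbT.
rewrite !pfactor_dvdn ?muln_gt0 ?a0 // lognM // => le_mn.
by apply: contraT; rewrite negb_or -!ltnNge; lia.
Qed.

Fact padic_int_mulf_eq0 : GRing.integral_domain_axiom (padic_int p_pr).
Proof.
move=> x y xy0; apply: contraT; rewrite negb_or.
case/andP=> /padic_int_neq0P[m xm] /padic_int_neq0P[n yn].
have /dvdz_mod0P : (x * y) (m + n)%N = 0 by rewrite xy0 /= mod0z.
rewrite dvdzE abszM => /(dvdn_trans (dvdn_exp2l p (leq_pred _))).
case/dvdn_primeX_mul/orP=> pxy.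
  have /dvdz_mod0P : ((p ^ m)%N %| x (m + n)%N)%Z := pxy.
  by rewrite residue_le ?leq_addr // => /eqP; rewrite (negPf xm).
have /dvdz_mod0P : ((p ^ n)%N %| y (m + n)%N)%Z := pxy.
by rewrite residue_le ?leq_addl // => /eqP; rewrite (negPf yn).
Qed.

HB.instance Definition _ :=
  GRing.ComUnitRing_isIntegral.Build (padic_int p_pr) padic_int_mulf_eq0.

End PadicIntRing.

(** The field Q_p. *)
Notation padic p_pr := {fraction padic_int p_pr}.

Section PadicNorm.
Context (p : nat) (p_pr : prime p).
Local Notation tofrac := (@FracField.tofrac _).
Local Notation "x %:F" := (tofrac x).

(* The junk value 0 is used only at z = 0. *)
Definition padic_int_ord (z : padic_int p_pr) : nat :=
  if pselect (exists n, z n.+1 != 0) is left z_neq0 then ex_minn z_neq0 else 0.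

Definition padic_ord (x : padic p_pr) : int :=
  (padic_int_ord \n_(repr x))%:Z - (padic_int_ord \d_(repr x))%:Z.

Lemma padic_int_ordP (z : padic_int p_pr) n :
  z n = 0 -> z n.+1 != 0 -> padic_int_ord z = n.
Proof.
move=> zn zn1; rewrite /padic_int_ord; case: pselect => [h|[]]; last by exists n.
case: ex_minnP => m zm /(_ n zn1) mn; apply/eqP; rewrite eqn_leq mn leqNgt.
apply/negP => mltn; move/eqP: zm; apply.
by rewrite -(residue_le z mltn) zn mod0z.
Qed.

Lemma padic_int_ord_neq0 (z : padic_int p_pr) : z != 0 ->
  z (padic_int_ord z) = 0 /\ z (padic_int_ord z).+1 != 0.
Proof.
case/padic_int_neq0P=> -[|n] zn.
  by case/eqP: zn; rewrite -(residue_mod z) expn0 modz1.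
rewrite /padic_int_ord; case: pselect => [h|[]]; last by exists n.
case: ex_minnP => m zm min_m; split=> //; case: m {zm} min_m => [|m] min_m.
  by rewrite -(residue_mod z) expn0 modz1.
by apply/eqP/negPn/negP => /min_m; rewrite ltnn.
Qed.

Lemma padic_int_ordM (x y : padic_int p_pr) : x != 0 -> y != 0 ->
  padic_int_ord (x * y) = (padic_int_ord x + padic_int_ord y)%N.
Proof.
move=> /padic_int_ord_neq0 [xm xm1] /padic_int_ord_neq0 [yn yn1].
move: (padic_int_ord x) (padic_int_ord y) xm xm1 yn yn1 => m n xm xm1 yn yn1.
apply: padic_int_ordP.
  apply/dvdz_mod0P; rewrite expnD PoszM; apply: dvdz_mul.
    by apply/dvdz_mod0P; rewrite residue_le ?leq_addr.
  by apply/dvdz_mod0P; rewrite residue_le ?leq_addl.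
apply/eqP => /dvdz_mod0P; rewrite dvdzE abszM.
have -> : (m + n).+1 = (m.+1 + n.+1).-1 by lia.
case/(dvdn_primeX_mul p_pr)/orP=> pxy.
  have /dvdz_mod0P : ((p ^ m.+1)%N %| x (m.+1 + n.+1).-1)%Z := pxy.
  by rewrite residue_le ?addnS ?ltnS ?leq_addr // => /eqP; rewrite (negPf xm1).
have /dvdz_mod0P : ((p ^ n.+1)%N %| y (m.+1 + n.+1).-1)%Z := pxy.
by rewrite residue_le ?addSn ?ltnS ?leq_addl // => /eqP; rewrite (negPf yn1).
Qed.

Lemma frac_numden (D : idomainType) (x : {fraction D}) :
  x = (\n_(repr x))%:F / (\d_(repr x))%:F.
Proof.
have d0 : (\d_(repr x))%:F != 0 :> {fraction D} by rewrite tofrac_eq0 denom_ratioP.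
apply: (canRL (mulfK d0)).
case: (repr x) (reprK x) d0 => -[n d] /= dn0 <- _.
unlock tofrac; rewrite ?piE.
apply/eqP; rewrite piE /FracField.equivf /= /FracField.mulf /= !numden_Ratio ?oner_eq0 ?mulr1 //.
by rewrite mulrC.
Qed.

Lemma padic_ord_frac (x y : padic_int p_pr) : x != 0 -> y != 0 ->
  padic_ord (x%:F / y%:F) = (padic_int_ord x)%:Z - (padic_int_ord y)%:Z.
Proof.
move=> x0 y0; rewrite /padic_ord.
set z := x%:F / y%:F.
have := frac_numden z; have := denom_ratioP (repr z).
have z0 : z != 0 by rewrite mulf_neq0 ?invr_eq0 ?tofrac_eq0.
move: (\n_(repr z)) (\d_(repr z)) => n d d0 E.
have n0 : n != 0 by apply: contraNneq z0 => n0; rewrite E n0 tofrac0 mul0r.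
move/eqP: E; rewrite eqr_div ?tofrac_eq0 // -!tofracM tofrac_eq => /eqP.
move/(congr1 padic_int_ord); rewrite !padic_int_ordM //; lia.
Qed.

Lemma padic_ordM (x y : padic p_pr) : x != 0 -> y != 0 ->
  padic_ord (x * y) = padic_ord x + padic_ord y.
Proof.
have := frac_numden x; have := frac_numden y.
move: (\n_(repr x)) (\d_(repr x)) (\n_(repr y)) (\d_(repr y)) => a b c d -> ->.
rewrite !mulf_eq0 !invr_eq0 !tofrac_eq0.
case/norP=> a0 b0; case/norP=> c0 d0.
have ca : a * c != 0 by exact: mulf_neq0.
have db : b * d != 0 by exact: mulf_neq0.
rewrite mulf_div -!tofracM !padic_ord_frac //.
rewrite ?padic_int_ordM //; lia.
Qed.

Definition padic_norm (R : realType) (x : padic p_pr) : R :=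
  if x == 0 then 0 else p%:R ^ (- padic_ord x).

Definition padic_ball (R : realType) (a : padic p_pr) (rho : R) :
  set (padic p_pr) := [set x | padic_norm R (x - a) < rho].

End PadicNorm.

Section Dynamics.

(** Partial maps are represented by a total function [f] together with the
    point [s] at which it is undefined; what [f] returns at [s] is never used. *)

Definition iter_preimage (X : eqType) (f : X -> X) (s : X) (n : nat)
    (S : set X) : set X :=
  [set x | (forall k, (k < n)%N -> iter k f x != s) /\ S (iter n f x)].

Definition isometrically_conjugate (R X Y : Type)
    (A : set X) (f : X -> X) (dX : X -> X -> R)
    (B : set Y) (g : Y -> Y) (dY : Y -> Y -> R) : Prop :=
  [/\ forall x, A x -> A (f x),
      forall y, B y -> B (g y) &
      exists h : X -> Y,
        [/\ set_bij A B h,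
            forall x x', A x -> A x' -> dY (h x) (h x') = dX x x' &
            forall x, A x -> h (f x) = g (h x)]].

Definition shift (T : Type) (u : nat -> T) : nat -> T := fun n => u n.+1.

End Dynamics.

(** The symbols 1, 2, 3 are the elements 0, 1, 2 of ['I_3]; accordingly
    [y i] and [fixed_pt theta q y i] stand for y^(i+1) and x^(i+1). *)

Section PottsBethe.
Context (R : realType) (p : nat) (p_pr : prime p) (theta q : padic p_pr).
Local Notation Qp := (padic p_pr).
Local Notation norm := (padic_norm R).

Definition padic_exp_domain : set Qp :=
  [set x | norm (x - 1) < p%:R `^ (- (p%:R - 1)^-1)].

Definition pole : Qp := 2 - theta - q.

Definition potts_bethe (x : Qp) : Qp :=
  ((theta * x + q - 1) / (x + theta + q - 2)) ^+ 3.

Definition fixed_pt_cubic : {poly Qp} :=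
  'X^3 - (1 + theta + theta ^+ 2) *: 'X^2
  - ((2 * theta + 1) * (1 - theta - q)) *: 'X - ((1 - theta - q) ^+ 2)%:P.

Definition labelled_roots (y : 'I_3 -> Qp) : Prop :=
  [/\ fixed_pt_cubic = \prod_(i < 3) ('X - (y i)%:P),
      norm (y 0) = 1,
      norm (y 1) = norm (1 - theta - q),
      norm (y 2) = norm (1 - theta - q) &
      norm (1 - theta - q) < 1].

Definition basin (a : Qp) : set Qp :=
  [set x | (forall n, iter n potts_bethe x != pole) /\
           (fun n => norm (iter n potts_bethe x - a)) @ \oo --> (0 : R)].

Section Coding.
Variable y : 'I_3 -> Qp.

Definition fixed_pt (i : 'I_3) : Qp := 1 - q + (theta - 1) * (y i - 1).

Definition coding_domain : set Qp :=
  \bigcup_(i : 'I_3) padic_ball (fixed_pt i) (norm q * norm (theta - 1)).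

Definition julia0 : set Qp :=
  \bigcap_(n : nat) iter_preimage potts_bethe pole n coding_domain.

(* p^tau_1 = |q| / |theta - 1| and p^tau_2 = p^tau_3 = 1 / (|q| |theta - 1|) *)
Definition tau (i : 'I_3) : int :=
  if i == 0 then padic_ord (theta - 1) - padic_ord q
  else padic_ord q + padic_ord (theta - 1).

Definition kappa (i j : 'I_3) : int := padic_ord (fixed_pt i - fixed_pt j).

Definition shift_dist (u v : nat -> 'I_3) : R :=
  if pselect (exists n, u n != v n) is left uv then
    let n := ex_minn uv in
    p%:R ^ (- (\sum_(k < n) tau (u k)) - kappa (u n) (v n))
  else 0.

End Coding.
End PottsBethe.

(* Main.v *)
(** In the coordinate [w = x - pole], writing [t = theta - 1] and
    [s = t + q], the map is the cube of [theta - t s / w], and the polynomial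
    whose roots are the fixed points gives the exact identity
    [f x - x = - (x - 1) (x - x1) (x - x2) (x - x3) / w ^ 3].  Its norm shows
    that a point with [|w| <= |t|] outside the three balls is sent to
    [|w| > |t|], from where one more step enters [|x - 1| < |q|], a ball
    contracted towards 1.  On each of the three balls [f] multiplies distances
    by a constant greater than 1, and, cube roots of units being available by
    Hensel lifting, its image of the ball covers [|x - x1| <= |t|], which
    contains all three.  Hence every itinerary is realised by exactly one point,
    the limit of the corresponding inverse branches.  Besides [|3| = 1], only
    the ultrametric inequality, discreteness and completeness of the norm
    matter. *)

From mathcomp Require Import all_boot all_order all_algebra.
From mathcomp Require Import zify ring.
From mathcomp Require Import boolp classical_sets functions reals.
From mathcomp Require Import topology normedtype sequences.
Require Import Defs.

Set Implicit Arguments.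
Unset Strict Implicit.
Unset Printing Implicit Defensive.

Import Order.TTheory GRing.Theory Num.Theory.
Import numFieldNormedType.Exports.
Local Open Scope ring_scope.
Local Open Scope classical_set_scope.

(** The bracket is [x ^+ 2 + x * y + y ^+ 2 - 3 * c ^+ 2], arranged so that every term contains
    [x - c] or [y - c]. This smallness makes the Newton step for the cube root of [z] contracting
    near [c]. *)
Lemma cube_newton_step (F : fieldType) (c z x y : F) : c != 0 -> 3 != 0 :> F ->
  x - (x ^+ 3 - z) / (3 * c ^+ 2) - (y - (y ^+ 3 - z) / (3 * c ^+ 2)) =
  - ((x - c) * (c + x) + (c * (x - c) + x * (y - c)) + (y - c) * (c + y))
  * (x - y) / (3 * c ^+ 2).
Proof. by move=> c0 three0; field; rewrite c0. Qed.

(** * Complete discretely normed fields *)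

Record nonarch_norm (R : realType) (K : fieldType) (N : K -> R) : Prop :=
  NonarchNorm {
    nrm0 : N 0 = 0;
    nrm_gt0 : forall x, (0 < N x) = (x != 0);
    nrmM : forall x y, N (x * y) = N x * N y;
    nrmD_le : forall x y e, N x <= e -> N y <= e -> N (x + y) <= e }.

Section NonarchNorm.
Context (R : realType) (K : fieldType) (N : K -> R) (nna : nonarch_norm N).
Implicit Types (x y : K) (e : R).

Lemma nrm_ge0 x : 0 <= N x.
Proof.
by have [->|x0] := eqVneq x 0; rewrite ?(nrm0 nna)// ltW// (nrm_gt0 nna).
Qed.

Lemma nrm_eq0 x : (N x == 0) = (x == 0).
Proof.
apply/idP/idP => [|/eqP->]; last by rewrite (nrm0 nna).
by apply: contraLR; rewrite -(nrm_gt0 nna) => /gt_eqF ->.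
Qed.

Lemma nrm1 : N 1 = 1.
Proof.
have N1 : N 1 != 0 by rewrite nrm_eq0 oner_eq0.
by apply: (mulfI N1); rewrite -(nrmM nna) !mulr1.
Qed.

Lemma nrmX x n : N (x ^+ n) = N x ^+ n.
Proof.
by elim: n => [|n IHn]; rewrite ?expr0 ?nrm1// !exprS (nrmM nna) IHn.
Qed.

Lemma nrmN x : N (- x) = N x.
Proof.
apply: (@pexpIrn _ 2); rewrite ?qualifE/= ?nrm_ge0//.
by rewrite -!nrmX sqrrN.
Qed.

Lemma nrmB x y : N (x - y) = N (y - x).
Proof. by rewrite -nrmN opprB. Qed.

Lemma nrmV x : N x^-1 = (N x)^-1.
Proof.
have [->|x0] := eqVneq x 0; first by rewrite invr0 (nrm0 nna) invr0.
have Nx0 : N x != 0 by rewrite nrm_eq0.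
by apply: (mulfI Nx0); rewrite -(nrmM nna) !divff// nrm1.
Qed.

Lemma nrm_div x y : N (x / y) = N x / N y.
Proof. by rewrite (nrmM nna) nrmV. Qed.

Lemma nrmB_le x y e : N x <= e -> N y <= e -> N (x - y) <= e.
Proof. by move=> Nx Ny; rewrite (nrmD_le nna) ?nrmN. Qed.

Lemma nrmD_lt x y e : N x < e -> N y < e -> N (x + y) < e.
Proof.
move=> Nx Ny; apply: (@le_lt_trans _ _ (Num.max (N x) (N y))).
  by rewrite (nrmD_le nna) ?le_max ?lexx ?orbT.
by rewrite gt_max Nx.
Qed.

Lemma nrmB_lt x y e : N x < e -> N y < e -> N (x - y) < e.
Proof. by move=> Nx Ny; rewrite nrmD_lt ?nrmN. Qed.

(** If [x + y] were smaller than [x], then [x], as the difference of [x + y] and [y], would be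
    smaller than itself. *)
Lemma nrmD_eq x y : N y < N x -> N (x + y) = N x.
Proof.
move=> yx; apply/eqP; rewrite eq_le (nrmD_le nna) ?(ltW yx)//=.
rewrite leNgt; apply/negP => xyx.
by have := nrmB_lt xyx yx; rewrite addrK ltxx.
Qed.

Lemma nrmB_eq x y : N y < N x -> N (x - y) = N x.
Proof. by move=> yx; rewrite nrmD_eq ?nrmN. Qed.

Lemma nrm_near x y : N (x - y) < N y -> N x = N y.
Proof. by move=> xy; rewrite -(subrK y x) addrC nrmD_eq. Qed.

Lemma nrm_nat_le n : N n%:R <= 1.
Proof.
elim: n => [|n IHn]; first by rewrite (nrm0 nna).
by rewrite mulrSr (nrmD_le nna) ?nrm1.
Qed.

End NonarchNorm.

(* [pi] is the norm of a uniformiser. *)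
Record complete_dvf (R : realType) (K : fieldType) (N : K -> R) (pi : R)
    : Prop := CompleteDvf {
  dvf_nonarch :> nonarch_norm N;
  dvf_pi : 0 < pi < 1;
  dvf_lt1 : forall x, N x < 1 -> N x <= pi;
  dvf_complete : forall u : nat -> K,
    (forall n, N (u n.+1 - u n) <= pi ^+ n) ->
    exists z, forall n, N (z - u n) <= pi ^+ n }.

Section CompleteDvf.
Context (R : realType) (K : fieldType) (N : K -> R) (pi : R)
  (dvf : complete_dvf N pi).
Implicit Types (x y z : K) (e : R).

Let pi_gt0 : 0 < pi. Proof. by case/andP: (dvf_pi dvf). Qed.
Let pi_lt1 : pi < 1. Proof. by case/andP: (dvf_pi dvf). Qed.

Lemma dvf_pow_small e : 0 < e -> exists n, pi ^+ n < e.
Proof.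
move=> e0; have pi1 : `|pi| < 1 by rewrite ger0_norm// ltW.
have := cvg_expr pi1.
move/cvgrPdist_lt => /(_ e e0) [n _ /(_ n (leqnn n))] /=.
by rewrite sub0r normrN ger0_norm ?exprn_ge0 1?ltW// => ?; exists n.
Qed.

Lemma dvf_small x : (forall n, N x <= pi ^+ n) -> x = 0.
Proof.
move=> small; apply/eqP; rewrite -(nrm_eq0 dvf) eq_le (nrm_ge0 dvf).
rewrite andbT leNgt; apply/negP => /dvf_pow_small[n].
by rewrite ltNge small.
Qed.

(** [z k] is the limit of the composites [phi k (phi k.+1 (... c))], which are Cauchy because every
    outer map contributes a factor [pi]. The maps may vary with [k] so that they can follow an
    itinerary. *)
Lemma backward_orbit (phi : nat -> K -> K) c e : 0 < e <= 1 ->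
  (forall k x, N (x - c) <= e -> N (phi k x - c) <= e) ->
  (forall k x y, N (x - c) <= e -> N (y - c) <= e ->
    N (phi k x - phi k y) <= pi * N (x - y)) ->
  exists z : nat -> K, forall k, N (z k - c) <= e /\ phi k (z k.+1) = z k.
Proof.
case/andP=> e0 e1 phi_ball phi_contr.
(* [F n k] applies the [n] maps from [phi k] to [phi (k + n - 1)] to [c], the highest index
   first. *)
pose F := fix F n k := if n is m.+1 then phi k (F m k.+1) else c.
have F_ball n k : N (F n k - c) <= e.
  elim: n k => [|n IHn] k /=; first by rewrite subrr (nrm0 dvf) ltW.
  exact: phi_ball.
have F_cauchy n k : N (F n.+1 k - F n k) <= pi ^+ n.
  elim: n k => [|n IHn] k /=.
    by rewrite expr0 (le_trans (F_ball 1%N k)).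
  apply: le_trans (phi_contr _ _ _ _ _) _ => //; first exact: (F_ball n.+1).
  by rewrite exprS ler_pM2l// IHn.
have /choice[z zP] : forall k, exists z, forall n, N (z - F n k) <= pi ^+ n.
  by move=> k; apply: (dvf_complete dvf (u := F^~ k)) => n; apply: F_cauchy.
have z_ball k : N (z k - c) <= e.
  have [n ne] := dvf_pow_small e0.
  rewrite -(subrK (F n k) (z k)) -addrA (nrmD_le dvf)//.
  by rewrite (le_trans (zP k n))// ltW.
exists z => k; split=> //; apply/esym/eqP; rewrite -subr_eq0; apply/eqP.
apply: dvf_small => n.
(* [F n.+1 k] unfolds to [phi k (F n k.+1)], so both differences are at most [pi ^+ n.+1]. *)
have -> : z k - phi k (z k.+1) =
    (z k - F n.+1 k) - (phi k (z k.+1) - phi k (F n k.+1)) by move=> /=; ring.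
apply: (@le_trans _ _ (pi ^+ n.+1)); last first.
  by rewrite exprS ler_piMl ?exprn_ge0 ?ltW.
rewrite (nrmB_le dvf)//; apply: le_trans (phi_contr _ _ _ _ _) _ => //.
by rewrite exprS ler_pM2l.
Qed.

(** Consecutive terms of a backward orbit of a single map differ by at most [pi ^+ n] for every [n],
    so the orbit is constant. *)
Lemma dvf_contraction (phi : K -> K) c e : 0 < e <= 1 ->
  (forall x, N (x - c) <= e -> N (phi x - c) <= e) ->
  (forall x y, N (x - c) <= e -> N (y - c) <= e ->
    N (phi x - phi y) <= pi * N (x - y)) ->
  exists2 x, N (x - c) <= e & phi x = x.
Proof.
move=> e01 phi_ball phi_contr.
have [z zP] := @backward_orbit (fun=> phi) c e e01 (fun=> phi_ball)
  (fun=> phi_contr).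
have zz n k : N (z k - z k.+1) <= pi ^+ n.
  elim: n k => [|n IHn] k.
    have -> : z k - z k.+1 = (z k - c) - (z k.+1 - c) by ring.
    case/andP: e01 => e0 e1; rewrite expr0 (nrmB_le dvf)//.
    - by rewrite (le_trans _ e1)//; case: (zP k).
    - by rewrite (le_trans _ e1)//; case: (zP k.+1).
  rewrite -(zP k).2 -{2}(zP k.+1).2; apply: le_trans (phi_contr _ _ _ _) _.
  - by case: (zP k.+1).
  - by case: (zP k.+2).
  by rewrite exprS ler_pM2l// IHn.
exists (z 0%N); first by case: (zP 0%N).
have z01 : z 0%N = z 1%N by apply/eqP; rewrite -subr_eq0; apply/eqP/dvf_small.
by rewrite {1}z01; case: (zP 0%N).
Qed.

(** Hensel lifting: as [3 * c ^+ 2] is a unit, the Newton step contracts the ball of radius [pi]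
    around [c], and its fixed points are cube roots of [z]. *)
Lemma dvf_cube_root c z : N 3 = 1 -> N c = 1 -> N (z - c ^+ 3) < 1 ->
  exists2 g, g ^+ 3 = z & N (g - c) < 1.
Proof.
move=> N3 Nc /(dvf_lt1 dvf) zc.
have c0 : c != 0 by rewrite -(nrm_gt0 dvf) Nc.
have three0 : 3 != 0 :> K by rewrite -(nrm_gt0 dvf) N3.
have N3c2 : N (3 * c ^+ 2) = 1.
  by rewrite (nrmM dvf) (nrmX dvf) N3 Nc expr1n mulr1.
(* Newton's iteration with the derivative frozen at [c] *)
pose phi g := g - (g ^+ 3 - z) / (3 * c ^+ 2).
have unit x : N (x - c) <= pi -> N x = 1.
  by move=> xc; rewrite (nrm_near dvf (x := x) (y := c)) ?Nc// (le_lt_trans xc).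
have phi_contr x y : N (x - c) <= pi -> N (y - c) <= pi ->
    N (phi x - phi y) <= pi * N (x - y).
  move=> xc yc; have Nx := unit x xc; have Ny := unit y yc.
  rewrite /phi cube_newton_step// (nrm_div dvf) N3c2 divr1.
  rewrite (nrmM dvf) (nrmN dvf).
  rewrite ler_wpM2r ?(nrm_ge0 dvf)//.
  have mul_le u v : N u <= pi -> N v <= 1 -> N (u * v) <= pi.
    by move=> Nu Nv; rewrite (nrmM dvf) -[leRHS]mulr1 ler_pM ?(nrm_ge0 dvf).
  apply: (nrmD_le dvf); first apply: (nrmD_le dvf).
  - by rewrite mul_le// (nrmD_le dvf) ?Nc ?Nx.
  - by rewrite (nrmD_le dvf)// mulrC mul_le ?Nc ?Nx.
  - by rewrite mul_le// (nrmD_le dvf) ?Nc ?Ny.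
have phi_ball x : N (x - c) <= pi -> N (phi x - c) <= pi.
  move=> xc; rewrite -(subrK (phi c) (phi x)) -addrA (nrmD_le dvf)//.
    apply: le_trans (phi_contr _ _ _ _) _ => //.
      by rewrite subrr (nrm0 dvf) ltW.
    by apply: le_trans xc; rewrite ler_piMl ?(nrm_ge0 dvf)// ltW.
  rewrite /phi addrAC subrr add0r (nrmN dvf) (nrm_div dvf) N3c2.
  by rewrite divr1 (nrmB dvf).
have [|g gc gE] := @dvf_contraction phi c pi _ phi_ball phi_contr.
  by rewrite pi_gt0 ltW.
exists g; last exact: le_lt_trans gc pi_lt1.
move/eqP: gE; rewrite /phi -subr_eq0 addrAC subrr add0r oppr_eq0.
rewrite !mulf_eq0 invr_eq0 mulf_eq0 expf_eq0 /= (negPf c0) (negPf three0).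
by rewrite !orbF subr_eq0 => /eqP.
Qed.

(** The cofactor of [u - v] in the difference of cubes is [3 * c ^+ 2], a unit, plus terms of norm
    less than 1. *)
Lemma norm_cube_sub c u v : N 3 = 1 -> N c = 1 -> N (u - c) < 1 ->
  N (v - c) < 1 -> N (u ^+ 3 - v ^+ 3) = N (u - v).
Proof.
move=> N3 Nc uc vc.
have -> : u ^+ 3 - v ^+ 3 = (u - v) * (3 * c ^+ 2
    + ((u - c) * (u + c) + (c * (v - c) + v * (u - c)) + (v - c) * (v + c))).
  by ring.
have Nu : N u = 1 by rewrite (nrm_near dvf (x := u) (y := c)) ?Nc.
have Nv : N v = 1 by rewrite (nrm_near dvf (x := v) (y := c)) ?Nc.
have N3c2 : N (3 * c ^+ 2) = 1.
  by rewrite (nrmM dvf) (nrmX dvf) N3 Nc expr1n mulr1.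
have mul_lt x y : N x < 1 -> N y <= 1 -> N (x * y) < 1.
  move=> Nx Ny; rewrite (nrmM dvf).
  by apply: le_lt_trans Nx; rewrite ler_piMr ?(nrm_ge0 dvf).
rewrite (nrmM dvf) [X in _ * X](nrmD_eq dvf) N3c2 ?mulr1//.
apply: (nrmD_lt dvf); first apply: (nrmD_lt dvf).
- by rewrite mul_lt// (nrmD_le dvf) ?Nc ?Nu.
- by rewrite (nrmD_lt dvf)// ?[c * _]mulrC ?[v * _]mulrC mul_lt ?Nc ?Nv.
- by rewrite mul_lt// (nrmD_le dvf) ?Nc ?Nv.
Qed.

End CompleteDvf.

(** * The Potts-Bethe mapping over such a field *)

Section FieldIdentities.
Context (F : fieldType) (theta q : F).
Implicit Types x y : F.

(** The map before cubing: a Moebius transformation of determinant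
    [(theta - 1) * (theta - 1 + q)]. *)
Definition potts_bethe_root x : F := (theta * x + q - 1) / (x + theta + q - 2).

Lemma potts_bethe_root_sub x y :
  x - (2 - theta - q) != 0 -> y - (2 - theta - q) != 0 ->
  potts_bethe_root x - potts_bethe_root y =
  (theta - 1) * (theta - 1 + q) * (x - y)
  / ((x - (2 - theta - q)) * (y - (2 - theta - q))).
Proof.
have den z : z + theta + q - 2 = z - (2 - theta - q) by ring.
by rewrite /potts_bethe_root !den => x0 y0; field; rewrite x0 y0.
Qed.

Lemma potts_bethe_root_sub1 x : x - (2 - theta - q) != 0 ->
  potts_bethe_root x - 1 = (theta - 1) * (x - 1) / (x - (2 - theta - q)).
Proof.
have den z : z + theta + q - 2 = z - (2 - theta - q) by ring.
by rewrite /potts_bethe_root !den => x0; field.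
Qed.

Lemma potts_bethe_root_subtheta x : x - (2 - theta - q) != 0 ->
  theta - potts_bethe_root x =
  (theta - 1) * (theta - 1 + q) / (x - (2 - theta - q)).
Proof.
have den z : z + theta + q - 2 = z - (2 - theta - q) by ring.
by rewrite /potts_bethe_root !den => x0; field.
Qed.

(** The argument comes from solving [potts_bethe_root_subtheta] for [x - (2 - theta - q)]. *)
Lemma potts_bethe_root_inv (g : F) : theta - 1 != 0 -> theta - 1 + q != 0 ->
  theta - g != 0 -> potts_bethe_root
    (2 - theta - q + (theta - 1) * (theta - 1 + q) / (theta - g)) = g.
Proof.
move=> t0 s0 g0; rewrite /potts_bethe_root.
have -> : 2 - theta - q + (theta - 1) * (theta - 1 + q) / (theta - g)
  + theta + q - 2 = (theta - 1) * (theta - 1 + q) / (theta - g) by ring.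
by field; rewrite g0 s0.
Qed.

Lemma cubic_vieta (A B C a b c : F) :
  'X^3 - A *: 'X^2 - B *: 'X - C%:P
    = ('X - a%:P) * ('X - b%:P) * ('X - c%:P) ->
  [/\ A = a + b + c, B = - (a * b + a * c + b * c) & C = a * b * c].
Proof.
move=> E.
have {}E : (A - (a + b + c)) *: 'X^2 + (B + (a * b + a * c + b * c)) *: 'X
    + (C - a * b * c)%:P = 0 :> {poly F}.
  transitivity ('X^3 - ('X^3 - A *: 'X^2 - B *: 'X - C%:P)
   - ((a + b + c)%:P * 'X^2 - (a * b + a * c + b * c)%:P * 'X
      + (a * b * c)%:P)).
    by rewrite -!mul_polyC !rmorphB !rmorphD !rmorphM/=; ring.
  by rewrite E !rmorphD !rmorphM/=; ring.
have cf k := congr1 (fun P : {poly F} => P`_k) E.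
split; apply/eqP; rewrite -subr_eq0 ?opprK.
- by have := cf 2%N; rewrite !coefE/= !(mulr0,mulr1,addr0,add0r) => ->.
- by have := cf 1%N; rewrite !coefE/= !(mulr0,mulr1,addr0,add0r) => ->.
- by have := cf 0%N; rewrite !coefE/= !(mulr0,mulr1,addr0,add0r) => ->.
Qed.

Section Roots.
Context (y0 y1 y2 : F).
Context (e1 : 1 + theta + theta ^+ 2 = y0 + y1 + y2)
  (e2 : (2 * theta + 1) * (1 - theta - q) = - (y0 * y1 + y0 * y2 + y1 * y2))
  (e3 : (1 - theta - q) ^+ 2 = y0 * y1 * y2).

(** In the coordinate [w] each factor [x - x_i] is [w - (theta - 1) * y_i], so the product of the
    three is the cubic homogenised in [w] and [theta - 1]. Its coefficients are known from [e1],
    [e2] and [e3], which leaves a polynomial identity. *)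
Lemma potts_bethe_sub_id x : x - (2 - theta - q) != 0 ->
  potts_bethe_root x ^+ 3 - x =
  - ((x - 1) * (x - (1 - q + (theta - 1) * (y0 - 1)))
     * (x - (1 - q + (theta - 1) * (y1 - 1)))
     * (x - (1 - q + (theta - 1) * (y2 - 1)))) / (x - (2 - theta - q)) ^+ 3.
Proof.
have den z : z + theta + q - 2 = z - (2 - theta - q) by ring.
rewrite /potts_bethe_root !den => x0; rewrite expr_div_n.
set w := x - (2 - theta - q) in x0 *; set s := 1 - theta - q.
have shift z : x - (1 - q + (theta - 1) * (z - 1)) = w - (theta - 1) * z.
  by rewrite /w; ring.
rewrite !shift; apply: (canRL (mulfK _)); first by rewrite expf_neq0.
rewrite mulrBl mulfVK ?expf_neq0//.
have -> : (x - 1) * (w - (theta - 1) * y0) * (w - (theta - 1) * y1)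
   * (w - (theta - 1) * y2) = (x - 1) * (w ^+ 3
   - (theta - 1) * (1 + theta + theta ^+ 2) * w ^+ 2
   - (theta - 1) ^+ 2 * ((2 * theta + 1) * s) * w
   - (theta - 1) ^+ 3 * s ^+ 2).
  by rewrite e1 e2 e3; ring.
by rewrite /w /s; ring.
Qed.

(* The bracket is [- 3] up to terms of norm less than 1, so the distance between
   the two small roots is exactly their norm. *)
Lemma cubic_roots_disc : 1 - theta - q != 0 ->
  let t := theta - 1 in
  let a := 2 * t + y1 * y2 / (1 - theta - q) in
  let b := 3 * t + t ^+ 2 - y1 - y2 in
  (y0 * (y1 - y2)) ^+ 2 =
  (1 - theta - q) ^+ 2 * (- 3 + (6 * a + a ^+ 2 - 4 * b)).
Proof.
move=> s0 t a b; move: s0 e2 e3 @a; set s := 1 - theta - q => s0 e2' e3' a.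
have a_def : s * (3 + a) = - (y0 * (y1 + y2)).
  transitivity ((2 * theta + 1) * s + y1 * y2); last by rewrite e2'; ring.
  by rewrite /a /t; field.
have b_def : y0 = 3 + b.
  transitivity (1 + theta + theta ^+ 2 - y1 - y2); first by rewrite e1; ring.
  by rewrite /b /t; ring.
(* By [a_def], [b_def] and [e3'] this is [s ^+ 2 * ((3 + a) ^+ 2 - 4 * (3 + b))]. *)
transitivity ((y0 * (y1 + y2)) ^+ 2 - 4 * y0 * (y0 * y1 * y2)); first by ring.
rewrite -e3' -[X in X ^+ 2 - _]opprK -a_def {1}b_def; ring.
Qed.
End Roots.
End FieldIdentities.

Lemma ord3_ind (P : 'I_3 -> Prop) : P 0 -> P 1 -> P 2 -> forall i, P i.
Proof.
move=> P0 P1 P2 [[|[|[|//]]] i3].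
- by rewrite (_ : Ordinal i3 = 0)//; apply: val_inj.
- by rewrite (_ : Ordinal i3 = 1)//; apply: val_inj.
- by rewrite (_ : Ordinal i3 = 2)//; apply: val_inj.
Qed.

(** * Norm estimates for the dynamics *)

Section PottsBetheDynamics.
Context (R : realType) (K : fieldType) (N : K -> R) (pi : R)
  (dvf : complete_dvf N pi) (N3 : N 3 = 1).
Context (theta q : K) (t_gt0 : 0 < N (theta - 1))
  (t_lt : N (theta - 1) < N q ^+ 2) (q2_lt1 : N q ^+ 2 < 1).
Local Notation T := (N (theta - 1)).
Local Notation S := (N q).
Local Notation b := (2 - theta - q).
Local Notation g := (potts_bethe_root theta q).
Local Notation f := (fun x => g x ^+ 3).
Implicit Types (x z : K) (i j : 'I_3).

Let S_ge0 : 0 <= S. Proof. exact: (nrm_ge0 dvf). Qed.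

Let S_lt1 : S < 1.
Proof. by rewrite -(@expr_lt1 _ 2). Qed.

Let S_gt0 : 0 < S.
Proof.
rewrite (nrm_gt0 dvf); apply/eqP => q0; move: (lt_trans t_gt0 t_lt).
by rewrite q0 (nrm0 dvf) expr0n ltxx.
Qed.

Let T_lt_S : T < S.
Proof. by apply: lt_trans t_lt _; rewrite expr2 gtr_pMr. Qed.

Let T_lt1 : T < 1. Proof. exact: lt_trans S_lt1. Qed.

Let norm_s : N (theta - 1 + q) = S.
Proof. by rewrite addrC (nrmD_eq dvf). Qed.

Let t_neq0 : theta - 1 != 0. Proof. by rewrite -(nrm_gt0 dvf). Qed.

Let s_neq0 : theta - 1 + q != 0.
Proof. by rewrite -(nrm_gt0 dvf) norm_s. Qed.

Let sub_pole x : x - b = x - 1 + (theta - 1 + q).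
Proof. by ring. Qed.

Let sub1 x : x - 1 = x - b - (theta - 1 + q).
Proof. by ring. Qed.

Let sub_subpole x z : x - b - (z - b) = x - z. Proof. by ring. Qed.

Lemma norm_root_sub x z : x - b != 0 -> z - b != 0 ->
  N (g x - g z) = T * S * N (x - z) / (N (x - b) * N (z - b)).
Proof.
move=> xb zb; rewrite potts_bethe_root_sub//.
by rewrite (nrm_div dvf) !(nrmM dvf) norm_s.
Qed.

Lemma norm_root_sub1 x : x - b != 0 -> N (g x - 1) = T * N (x - 1) / N (x - b).
Proof.
move=> xb; rewrite potts_bethe_root_sub1//.
by rewrite (nrm_div dvf) !(nrmM dvf).
Qed.

Lemma norm_root_subtheta x : x - b != 0 -> N (theta - g x) = T * S / N (x - b).
Proof.
move=> xb; rewrite potts_bethe_root_subtheta//.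
by rewrite (nrm_div dvf) !(nrmM dvf) norm_s.
Qed.

(** With [w = x - b], the norm of [g x - 1] is [T * N (x - 1) / N w]. If [S <= N w], then
    [N (x - 1) <= N w] and the quotient is at most [T < S]; otherwise [N (x - 1) = S] and [T < N w]
    gives the bound. Cubing is isometric near 1. *)
Lemma potts_bethe_far x : T < N (x - b) -> N (f x - 1) < S.
Proof.
move=> Tx; have xb : x - b != 0 by rewrite -(nrm_gt0 dvf) (lt_trans t_gt0).
have xb0 := lt_trans t_gt0 Tx.
have gx : N (g x - 1) < S.
  rewrite norm_root_sub1// ltr_pdivrMr//.
  have [Sx|xS] := leP S (N (x - b)).
    apply: (@le_lt_trans _ _ (T * N (x - b))); last by rewrite ltr_pM2r.
    by rewrite ler_pM2l// (sub1 x) (nrmB_le dvf) ?norm_s.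
  by rewrite (sub1 x) (nrmB dvf) (nrmB_eq dvf) ?norm_s// mulrC ltr_pM2l.
rewrite -(expr1n K 3) (@norm_cube_sub _ _ _ _ dvf 1)// ?(nrm1 dvf)//.
  by rewrite (lt_trans gx).
by rewrite subrr (nrm0 dvf).
Qed.

(** Here [N (x - b) = S], so [g] scales the distance to 1 by [T / S], which is below [S] because
    [T < S ^+ 2]. *)
Lemma potts_bethe_attracted x : N (x - 1) < S ->
  x - b != 0 /\ N (f x - 1) <= S * N (x - 1).
Proof.
move=> xS; have xb : N (x - b) = S.
  by rewrite (sub_pole x) addrC (nrmD_eq dvf) norm_s.
have xb0 : x - b != 0 by rewrite -(nrm_gt0 dvf) xb.
have gx : N (g x - 1) <= S * N (x - 1).
  rewrite norm_root_sub1// xb ler_pdivrMr// mulrAC.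
  by rewrite ler_wpM2r ?(nrm_ge0 dvf)// -expr2 ltW.
split=> //.
rewrite -{1}(expr1n K 3) (@norm_cube_sub _ _ _ _ dvf 1)// ?(nrm1 dvf)//.
  apply: le_lt_trans gx _; apply: lt_trans S_lt1.
  by rewrite gtr_pMr// (lt_trans xS).
by rewrite subrr (nrm0 dvf).
Qed.

Lemma potts_bethe_basin x n : N (x - 1) < S ->
  iter n f x - b != 0 /\ N (iter n f x - 1) <= S ^+ n * N (x - 1).
Proof.
move=> xS.
have step : N (iter n f x - 1) <= S ^+ n * N (x - 1).
  elim: n => [|n IHn]; first by rewrite mul1r.
  have [|_ fx] := @potts_bethe_attracted (iter n f x).
    by rewrite (le_lt_trans IHn)// (le_lt_trans _ xS)// ler_piMl
      ?(nrm_ge0 dvf)// exprn_ile1// ltW.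
  by apply: le_trans fx _; rewrite exprS -mulrA ler_pM2l.
split=> //; have [|//] := @potts_bethe_attracted (iter n f x).
by rewrite (le_lt_trans step)// (le_lt_trans _ xS)// ler_piMl
  ?(nrm_ge0 dvf)// exprn_ile1// ltW.
Qed.

Lemma norm_subs : N (1 - theta - q) = S.
Proof. by rewrite -norm_s -(nrmN dvf); congr N; ring. Qed.

Section Roots.
Context (y : 'I_3 -> K)
  (e1 : 1 + theta + theta ^+ 2 = y 0 + y 1 + y 2)
  (e2 : (2 * theta + 1) * (1 - theta - q)
     = - (y 0 * y 1 + y 0 * y 2 + y 1 * y 2))
  (e3 : (1 - theta - q) ^+ 2 = y 0 * y 1 * y 2)
  (Ny0 : N (y 0) = 1) (Ny1 : N (y 1) = S) (Ny2 : N (y 2) = S).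
Local Notation a i := (1 - q + (theta - 1) * (y i - 1)).

Let s'_neq0 : 1 - theta - q != 0.
Proof. by rewrite -(nrm_gt0 dvf) norm_subs. Qed.

(** As [y 1] and [y 2] have the same norm, the ultrametric inequality alone only bounds the left
    side by [S]. Equality comes from the discriminant identity, whose bracket has the norm of
    [- 3]. *)
Lemma norm_roots12_sub : N (y 1 - y 2) = S.
Proof.
apply: (@pexpIrn _ 2); rewrite ?qualifE/= ?(nrm_ge0 dvf)//.
have := congr1 N (cubic_roots_disc e1 e2 e3 s'_neq0).
rewrite /= exprMn (nrmM dvf) !(nrmX dvf) Ny0 expr1n mul1r => ->.
rewrite (nrmM dvf) (nrmX dvf) norm_subs.
set a := 2 * _ + _; set b := _ - y 1 - y 2.
have small n x : N x < 1 -> N (n%:R * x) < 1.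
  move=> x1; rewrite (nrmM dvf); apply: le_lt_trans x1.
  by rewrite ler_piMl ?(nrm_ge0 dvf)// (nrm_nat_le dvf).
have a1 : N a < 1.
  rewrite (nrmD_lt dvf) ?small//.
  by rewrite (nrm_div dvf) (nrmM dvf) Ny1 Ny2 norm_subs mulfK ?gt_eqF.
have b1 : N b < 1.
  rewrite !(nrmB_lt dvf) ?Ny1 ?Ny2// (nrmD_lt dvf) ?small//.
  by rewrite (nrmX dvf) exprn_ilt1 ?(nrm_ge0 dvf).
rewrite [X in _ * X](nrmD_eq dvf) (nrmN dvf) N3 ?mulr1//.
rewrite (nrmB_lt dvf) ?small// (nrmD_lt dvf) ?small//.
by rewrite (nrmX dvf) exprn_ilt1 ?(nrm_ge0 dvf).
Qed.

Lemma fixed_pt_sub_pole i : a i - b = (theta - 1) * y i.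
Proof. by ring. Qed.

(** The lower bound, the radius of the coding balls, makes these balls disjoint; the upper bound
    puts all centres into one closed ball of radius [T]. *)
Lemma norm_fixed_pt_sub i j : i != j ->
  T * S <= N (a i - a j) <= T.
Proof.
have E k l : a k - a l = (theta - 1) * (y k - y l) by ring.
rewrite E (nrmM dvf) -{4}[T]mulr1 !ler_pM2l//.
have N01 : N (y 0 - y 1) = 1 by rewrite (nrmB_eq dvf) ?Ny0 ?Ny1.
have N02 : N (y 0 - y 2) = 1 by rewrite (nrmB_eq dvf) ?Ny0 ?Ny2.
have N12 := norm_roots12_sub.
have sym k l e : N (y k - y l) = e -> N (y l - y k) = e by rewrite (nrmB dvf).
by elim/ord3_ind: i; elim/ord3_ind: j => //= _;
  rewrite ?(N01, N02, N12, sym _ _ _ N01, sym _ _ _ N02, sym _ _ _ N12);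
  rewrite ?lexx ?ltW.
Qed.

Lemma norm_fixed_pt_sub_pole i : N (a i - b) = if i == 0 then T else T * S.
Proof.
rewrite fixed_pt_sub_pole (nrmM dvf).
by elim/ord3_ind: i; rewrite ?Ny0 ?Ny1 ?Ny2 ?mulr1.
Qed.

Let d_ge i : T * S <= N (a i - b).
Proof.
by rewrite norm_fixed_pt_sub_pole; case: ifP => // _; rewrite ler_piMr ?ltW.
Qed.

Let d_le i : N (a i - b) <= T.
Proof.
by rewrite norm_fixed_pt_sub_pole; case: ifP => // _; rewrite ler_piMr ?ltW.
Qed.

Let TS_gt0 : 0 < T * S. Proof. exact: mulr_gt0. Qed.

Let d_gt0 i : 0 < N (a i - b). Proof. exact: lt_le_trans (d_ge i). Qed.

Let ab_neq0 i : a i - b != 0. Proof. by rewrite -(nrm_gt0 dvf). Qed.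

Lemma fixed_ptP i : f (a i) = a i.
Proof.
apply/eqP; rewrite -subr_eq0 (potts_bethe_sub_id e1 e2 e3)//.
by elim/ord3_ind: i; rewrite subrr !(mulr0, mul0r) oppr0 mul0r.
Qed.

Lemma norm_ball_sub_pole i x : N (x - a i) < T * S -> N (x - b) = N (a i - b).
Proof.
move=> xa; apply: (nrm_near dvf); apply: lt_le_trans (d_ge i).
by rewrite sub_subpole.
Qed.

Let norm_fixed_pt i : N (a i) = 1.
Proof.
rewrite -(nrm1 dvf); apply: (nrm_near dvf); rewrite (sub1 (a i)) (nrm1 dvf).
by rewrite (nrmB_lt dvf) ?norm_s// (le_lt_trans (d_le i)).
Qed.

Let norm_root_fixed_pt i : N (g (a i)) = 1.
Proof.
have /eqP := congr1 N (fixed_ptP i); rewrite norm_fixed_pt (nrmX dvf).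
by rewrite pexpr_eq1 ?(nrm_ge0 dvf)// => /eqP.
Qed.

Let root_near i x : N (x - a i) < T * S -> N (g x - g (a i)) < 1.
Proof.
move=> xa; have xb := norm_ball_sub_pole xa.
have xb0 : x - b != 0 by rewrite -(nrm_gt0 dvf) xb.
rewrite norm_root_sub// xb ltr_pdivrMr ?mulr_gt0// mul1r.
apply: (@lt_le_trans _ _ (T * S * (T * S))); first by rewrite ltr_pM2l.
by rewrite ler_pM// ltW.
Qed.

(** [N (x - b)] is constant on the ball, so [g] scales distances by the stated constant. By
    [root_near] its values stay close to the unit [g (a i)], where cubing is isometric. *)
Lemma potts_bethe_expand i x z : N (x - a i) < T * S -> N (z - a i) < T * S ->
  N (f x - f z) = T * S / N (a i - b) ^+ 2 * N (x - z).
Proof.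
move=> xa za.
have xb := norm_ball_sub_pole xa; have zb := norm_ball_sub_pole za.
have xb0 : x - b != 0 by rewrite -(nrm_gt0 dvf) xb.
have zb0 : z - b != 0 by rewrite -(nrm_gt0 dvf) zb.
rewrite (@norm_cube_sub _ _ _ _ dvf (g (a i))) ?root_near//.
by rewrite norm_root_sub// xb zb mulrAC expr2.
Qed.

(** The preimage is built backwards: take the cube root [c] of [z] near [g (a i)], then invert the
    Moebius map at [c]. *)
Lemma potts_bethe_onto i z : N (z - a i) <= T ->
  exists2 x, N (x - a i) < T * S & f x = z.
Proof.
move=> za.
have [|c cz ca] := dvf_cube_root dvf (z := z) N3 (norm_root_fixed_pt i).
  by rewrite (fixed_ptP i) (le_lt_trans za).
have {}za : N (c - g (a i)) <= T.
  rewrite -(@norm_cube_sub _ _ _ _ dvf (g (a i)))// ?cz ?(fixed_ptP i)//.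
  by rewrite subrr (nrm0 dvf).
(* [theta - g (a i)] has norm [T * S / N (a i - b)], at least [S > T], so moving from [g (a i)] to
   [c] does not change it. *)
have thc : N (theta - c) = T * S / N (a i - b).
  rewrite -norm_root_subtheta//; apply: (nrm_near dvf).
  have -> : theta - c - (theta - g (a i)) = g (a i) - c by ring.
  rewrite (nrmB dvf) norm_root_subtheta//; apply: le_lt_trans za _.
  rewrite ltr_pdivlMr// ltr_pM2l//; exact: le_lt_trans (d_le i) _.
have thc0 : theta - c != 0 by rewrite -(nrm_gt0 dvf) thc divr_gt0.
exists (b + (theta - 1) * (theta - 1 + q) / (theta - c)); last first.
  by rewrite potts_bethe_root_inv.
set x := b + _.
have xb : N (x - b) = N (a i - b).
  rewrite /x addrAC subrr add0r (nrm_div dvf) (nrmM dvf) norm_s thc.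
  by rewrite invfM invrK mulrA divff ?mul1r// gt_eqF.
have xb0 : x - b != 0 by rewrite -(nrm_gt0 dvf) xb.
move: za; rewrite -{1}(potts_bethe_root_inv t_neq0 s_neq0 thc0) -/x.
rewrite norm_root_sub// xb ler_pdivrMr ?mulr_gt0// => xa.
(* [T * S * N (x - a i)] is at most [T * N (a i - b) ^+ 2 <= T ^+ 3], and [T < S ^+ 2] makes this
   less than [(T * S) ^+ 2]. *)
rewrite -(ltr_pM2l TS_gt0); apply: le_lt_trans xa _.
apply: (@le_lt_trans _ _ (T * (T * T))).
  by rewrite ler_pM2l// ler_pM// ltW.
by rewrite -[T * S * _]mulrA ltr_pM2l// mulrCA ltr_pM2l// -expr2.
Qed.

(** If [f x] also lay within [T] of the pole, then [N (f x - x) <= T]. The product formula for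
    [f x - x] contradicts this, since no factor [x - a i] is small enough. *)
Lemma potts_bethe_escape x : x - b != 0 -> N (x - b) <= T ->
  (forall i, T * S <= N (x - a i)) -> T < N (f x - b).
Proof.
move=> xb0 xT xa; set D := N (x - b) in xT *.
have D0 : 0 < D by rewrite /D (nrm_gt0 dvf).
rewrite ltNge; apply/negP => fT.
have : N (f x - x) <= T.
  have -> : f x - x = (f x - b) - (x - b) by ring.
  exact: (nrmB_le dvf).
apply/negP; rewrite -ltNge (potts_bethe_sub_id e1 e2 e3)//.
rewrite (nrm_div dvf) (nrmN dvf) (nrmX dvf) -/D !(nrmM dvf).
rewrite ltr_pdivlMr ?exprn_gt0//.
have -> : N (x - 1) = S.
  by rewrite (sub1 x) (nrmB dvf) (nrmB_eq dvf) ?norm_s// (le_lt_trans xT).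
have shift i : x - a i = (x - b) - (a i - b) by ring.
have [DT|TD] := ltP D T.
  have n0 : N (x - a 0) = T.
    by rewrite shift (nrmB dvf) (nrmB_eq dvf) norm_fixed_pt_sub_pole.
  (* If [x] were closer to [a i] than [D], then [D] would equal [N (a i - b) = T * S], and [x] would
     lie in the excluded ball. *)
  have ni i : i != 0 -> D <= N (x - a i).
    move=> i0; rewrite leNgt; apply/negP => xD.
    have : D = N (a i - b).
      apply/esym; apply: (nrm_near dvf).
      by rewrite sub_subpole (nrmB dvf).
    rewrite norm_fixed_pt_sub_pole (negPf i0) => DE.
    by have := xa i; rewrite leNgt -DE xD.
  rewrite n0.
  have D1 := ni 1 isT; have D2 := ni 2 isT.
  apply: (@lt_le_trans _ _ (S * T * D * D)).
    rewrite (_ : T * D ^+ 3 = D * (T * D * D)); last by ring.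
    rewrite (_ : S * T * D * D = S * (T * D * D)); last by ring.
    by rewrite ltr_pM2r ?mulr_gt0// (lt_trans DT).
  have ST0 : 0 < S * T by exact: mulr_gt0.
  by rewrite ler_pM ?ler_pM2l// ltW ?mulr_gt0.
(* On the sphere [D = T] only [a 0] can be closer to [x] than [T], and then [T * S <= N (x - a 0)]
   together with [T < S ^+ 2] suffices. *)
have {TD xT} DT : D = T by apply/eqP; rewrite eq_le xT.
have ni i : i != 0 -> N (x - a i) = T.
  move=> i0; rewrite shift (nrmB_eq dvf) -/D ?DT//.
  by rewrite norm_fixed_pt_sub_pole (negPf i0) gtr_pMr.
rewrite DT (ni 1)// (ni 2)//.
rewrite [ltRHS](_ : _ = (S * N (x - a 0)) * (T * T)); last by ring.
rewrite [ltLHS](_ : _ = (T * T) * (T * T)); last by ring.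
rewrite ltr_pM2r ?mulr_gt0//.
apply: (@lt_le_trans _ _ (S * (T * S))).
  by rewrite mulrCA ltr_pM2l// -expr2.
by rewrite ler_pM2l.
Qed.

(** * Itineraries through the three balls *)

Section Coding.
Local Notation E i := (T * S / N (a i - b) ^+ 2).
Local Notation X x := (exists i, N (x - a i) < T * S).
Local Notation J x := (forall n, X (iter n f x)).

Lemma norm_ball_sub i j x z : i != j -> N (x - a i) < T * S ->
  N (z - a j) < T * S -> N (x - z) = N (a i - a j).
Proof.
move=> ij xa za; apply: (nrm_near dvf).
have -> : x - z - (a i - a j) = (x - a i) - (z - a j) by ring.
have /andP[+ _] := norm_fixed_pt_sub ij.
by apply: lt_le_trans; rewrite (nrmB_lt dvf).
Qed.

Lemma coding_ball_inj i j x :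
  N (x - a i) < T * S -> N (x - a j) < T * S -> i = j.
Proof.
move=> xi xj; apply/eqP/negPn/negP => ij.
have /andP[+ _] := norm_fixed_pt_sub ij.
by rewrite -(norm_ball_sub ij xi xj) subrr (nrm0 dvf) leNgt TS_gt0.
Qed.

Lemma ball_neq_pole i x : N (x - a i) < T * S -> x - b != 0.
Proof. by move=> /norm_ball_sub_pole xb; rewrite -(nrm_gt0 dvf) xb. Qed.

Let E_gt0 i : 0 < E i. Proof. by rewrite divr_gt0// exprn_gt0. Qed.

(** [E i > 1] since [N (a i - b) ^+ 2 <= T ^+ 2 < T * S]. Its inverse is itself a value of the norm,
    so discreteness improves [< 1] to [<= pi]. *)
Let E_inv i : (E i)^-1 <= pi.
Proof.
have NE : N ((a i - b) ^+ 2 / ((theta - 1) * (theta - 1 + q))) = (E i)^-1.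
  by rewrite (nrm_div dvf) (nrmX dvf) (nrmM dvf) norm_s invf_div.
rewrite -NE; apply: (dvf_lt1 dvf); rewrite NE invf_lt1//.
rewrite ltr_pdivlMr ?exprn_gt0// mul1r.
apply: (@le_lt_trans _ _ (T ^+ 2)).
  by rewrite lerXn2r ?qualifE/= ?(nrm_ge0 dvf)// d_le.
by rewrite expr2 ltr_pM2l.
Qed.

Lemma iter_expand (u : nat -> 'I_3) x z n :
  (forall k, (k < n)%N -> N (iter k f x - a (u k)) < T * S) ->
  (forall k, (k < n)%N -> N (iter k f z - a (u k)) < T * S) ->
  N (iter n f x - iter n f z) = (\prod_(k < n) E (u k)) * N (x - z).
Proof.
elim: n => [|n IHn] xu zu; first by rewrite big_ord0 mul1r.
rewrite big_ord_recr/= (potts_bethe_expand (xu n _) (zu n _))//.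
rewrite IHn; first by rewrite mulrCA mulrA.
- by move=> k kn; apply: xu; apply: ltnW.
- by move=> k kn; apply: zu; apply: ltnW.
Qed.

(** The [n]-th iterates stay within [T * S < 1] of each other, while [n] steps expand the initial
    distance by at least [pi ^- n]. *)
Lemma coding_inj (u : nat -> 'I_3) x z :
  (forall k, N (iter k f x - a (u k)) < T * S) ->
  (forall k, N (iter k f z - a (u k)) < T * S) -> x = z.
Proof.
move=> xu zu; apply/eqP; rewrite -subr_eq0; apply/eqP/(dvf_small dvf) => n.
have := iter_expand (fun k _ => xu k) (fun k _ => zu k) (n := n).
have P0 : 0 < \prod_(k < n) E (u k) by apply: prodr_gt0 => k _; exact: E_gt0.
move/(canLR (mulKf (lt0r_neq0 P0))) => <-.
apply: (@le_trans _ _ ((\prod_(k < n) E (u k))^-1)).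
  rewrite ler_piMr ?invr_ge0 ?ltW//; apply: (@lt_trans _ _ (T * S)).
    have -> : iter n f x - iter n f z =
       (iter n f x - a (u n)) - (iter n f z - a (u n)) by ring.
    exact: (nrmB_lt dvf).
  by rewrite mulr_ilt1 ?ltW.
rewrite -prodfV (_ : pi ^+ n = \prod_(k < n) pi); last first.
  by rewrite prodr_const card_ord.
by apply: ler_prod => k _; rewrite invr_ge0 (ltW (E_gt0 _)) E_inv.
Qed.

(** The two orbits visit the same balls for [n] steps, each expanding by [E (u k)], and then lie in
    different balls, whose distance is that of the centres. *)
Lemma coding_dist (u v : nat -> 'I_3) x z n :
  (forall k, N (iter k f x - a (u k)) < T * S) ->
  (forall k, N (iter k f z - a (v k)) < T * S) ->
  (forall k, (k < n)%N -> u k = v k) -> u n != v n ->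
  N (x - z) = (\prod_(k < n) E (u k))^-1 * N (a (u n) - a (v n)).
Proof.
move=> xu zv uv un; rewrite -(norm_ball_sub un (xu n) (zv n)).
rewrite (@iter_expand u)//; last by move=> k kn; rewrite uv.
rewrite mulKf//; apply/lt0r_neq0/prodr_gt0 => k _; exact: E_gt0.
Qed.

(** The inverse branches of [f] contract the closed ball of radius [T] around [a 0]; composing them
    along [u] gives a backward orbit, which is a forward orbit of [f]. *)
Lemma coding_surj (u : nat -> 'I_3) :
  exists x, forall k, N (iter k f x - a (u k)) < T * S.
Proof.
have ball i z : N (z - a i) < T * S -> N (z - a 0) <= T.
  move=> za; have zT : N (z - a i) <= T.
    by apply/ltW/(lt_trans za); rewrite gtr_pMr.
  have [<-//|i0] := eqVneq i 0.
  rewrite -(subrK (a i) z) -addrA (nrmD_le dvf)//.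
  by have /andP[] := norm_fixed_pt_sub i0.
have big i z : N (z - a 0) <= T -> N (z - a i) <= T.
  move=> za; have [->//|i0] := eqVneq i 0.
  rewrite -(subrK (a 0) z) -addrA (nrmD_le dvf)//.
  by rewrite eq_sym in i0; have /andP[] := norm_fixed_pt_sub i0.
(* [psi (i, z)] is the preimage of [z] in the ball of [a i]; the value 0 outside the large ball is a
   default. *)
have /choice[psi psiP] : forall iz : 'I_3 * K, exists x, N (iz.2 - a 0) <= T ->
    N (x - a iz.1) < T * S /\ f x = iz.2.
  move=> [i z]; have [zT|/negP zT] := boolP (N (z - a 0) <= T);
    last by exists 0.
  by have [x xa fx] := potts_bethe_onto (big i z zT); exists x.
have [| | |z zP] := backward_orbit dvf (phi := fun k z => psi (u k, z))
    (c := a 0) (e := T).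
- by rewrite t_gt0 ltW.
- by move=> k x xT; apply: (ball (u k)); case: (psiP (u k, x) xT).
- move=> k x w xT wT; have [xa fx] := psiP (u k, x) xT.
  have [wa fw] := psiP (u k, w) wT.
  rewrite /= in fx fw; rewrite -[in leRHS]fx -[in leRHS]fw.
  rewrite (potts_bethe_expand xa wa) mulrA ler_peMl ?(nrm_ge0 dvf)//.
  by rewrite -ler_pdivrMr// div1r E_inv.
exists (z 0%N) => k.
have zS n : f (z n) = z n.+1.
  by rewrite -{1}(zP n).2; case: (psiP (u n, z n.+1) (zP n.+1).1).
have -> : iter k f (z 0%N) = z k by elim: k => [//|n IHn]; rewrite iterS IHn zS.
by rewrite -(zP k).2; case: (psiP (u k, z k.+1) (zP k.+1).1).
Qed.

(** Once an iterate leaves the balls, it is either already far from the pole, one step from the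
    basin, or it gets far in one step. *)
Lemma escape_to_basin x : (forall n, iter n f x - b != 0) -> ~ J x ->
  exists m, N (iter m f x - 1) < S.
Proof.
move=> xb /existsNP[n /forallNP nX].
have [Tx|xT] := ltP T (N (iter n f x - b)).
  by exists n.+1; apply: potts_bethe_far.
exists n.+2; apply: potts_bethe_far; apply: (potts_bethe_escape (xb n) xT) => i.
by rewrite leNgt; apply/negP/nX.
Qed.

End Coding.

End Roots.
End PottsBetheDynamics.

(** * The p-adic norm *)

Section PadicNormTheory.
Context (R : realType) (p : nat) (p_pr : prime p).
Local Notation Qp := (padic p_pr).
Local Notation N := (@padic_norm p p_pr R).
Local Notation "x %:F" := (@FracField.tofrac _ x).
Implicit Types (x y z : Qp) (e : R).

Let p_gt0 : 0 < p%:R :> R. Proof. by rewrite ltr0n prime_gt0. Qed.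
Let p_gt1 : 1 < p%:R :> R. Proof. by rewrite ltr1n prime_gt1. Qed.
Let p_neq0 : p%:R != 0 :> R. Proof. by rewrite gt_eqF. Qed.

Lemma padic_norm0 : N 0 = 0.
Proof. by rewrite /padic_norm eqxx. Qed.

Lemma padic_norm_gt0 x : (0 < N x) = (x != 0).
Proof.
rewrite /padic_norm; case: eqP => _ /=; first by rewrite ltxx.
by rewrite exprz_gt0.
Qed.

Lemma padic_normE x : x != 0 -> N x = p%:R ^ (- padic_ord x).
Proof. by rewrite /padic_norm => /negPf->. Qed.

Lemma padic_normM x y : N (x * y) = N x * N y.
Proof.
have [->|x0] := eqVneq x 0; first by rewrite mul0r padic_norm0 mul0r.
have [->|y0] := eqVneq y 0; first by rewrite mulr0 padic_norm0 mulr0.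
by rewrite !padic_normE ?mulf_neq0// padic_ordM// opprD expfzDr.
Qed.

Lemma padic_norm_int (z : padic_int p_pr) : z != 0 ->
  N z%:F = p%:R ^- padic_int_ord z.
Proof.
move=> z0; rewrite padic_normE ?tofrac_eq0// exprnN.
have := @padic_ord_frac p p_pr z 1 z0 (oner_neq0 _).
rewrite tofrac1 divr1 => ->; rewrite [X in _ - X%:Z](_ : _ = 0%N) ?subr0//.
apply: padic_int_ordP; rewrite /= ?expn0 ?modz1// expn1 modz_small//.
by rewrite ltz_nat prime_gt1.
Qed.

(** This translates norm bounds on p-adic integers into vanishing residues, on which the ultrametric
    inequality and completeness rest. *)
Lemma padic_norm_int_le (z : padic_int p_pr) n :
  (N z%:F <= p%:R ^- n) = (z n == 0).
Proof.
have [->|z0] := eqVneq z 0.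
  by rewrite tofrac0 padic_norm0 invr_ge0 exprn_ge0 ?ltW//= mod0z eqxx.
rewrite padic_norm_int// !exprnN ler_eXz2l// lerN2 lez_nat.
have [zo zo1] := padic_int_ord_neq0 z0.
apply/idP/eqP => [le|zn].
  by rewrite -(residue_le z le) zo mod0z.
rewrite leqNgt; apply/negP => lt; move/eqP: zo1; apply.
by rewrite -(residue_le z lt) zn mod0z.
Qed.

(** Multiplying by a common denominator reduces to p-adic integers [u] and [v]; where the residues
    of both vanish, so does that of the sum. *)
Lemma padic_normD_le x y e : N x <= e -> N y <= e -> N (x + y) <= e.
Proof.
wlog lexy : x y / N x <= N y => [wlg Nx Ny|Nx Ny].
  by have [/wlg|/ltW/wlg] := leP (N x) (N y); last rewrite addrC; exact.
apply: le_trans Ny; move: lexy {Nx}.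
have := frac_numden x; have := denom_ratioP (repr x).
have := frac_numden y; have := denom_ratioP (repr y).
move: (\n_(repr x)) (\d_(repr x)) (\n_(repr y)) (\d_(repr y)).
move=> a b c d d0 yE b0 xE.
have Nbd : 0 < N (b * d)%:F by rewrite padic_norm_gt0 tofrac_eq0 mulf_neq0.
rewrite -(ler_pM2r Nbd) => Nxy; rewrite -(ler_pM2r Nbd); move: Nxy.
rewrite -!padic_normM.
have -> : x * (b * d)%:F = (a * d)%:F.
  by rewrite xE !tofracM mulrA mulfVK ?tofrac_eq0.
have -> : (x + y) * (b * d)%:F = (a * d + c * b)%:F.
  rewrite mulrDl tofracD xE yE !tofracM mulrA mulfVK ?tofrac_eq0//.
  by rewrite [b%:F * _]mulrC mulrA mulfVK ?tofrac_eq0.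
have -> : y * (b * d)%:F = (c * b)%:F.
  by rewrite yE !tofracM [b%:F * _]mulrC mulrA mulfVK ?tofrac_eq0.
move: (a * d) (c * b) => u v.
have [->|v0] := eqVneq v 0.
  by rewrite addr0 tofrac0 padic_norm0.
rewrite (padic_norm_int v0) padic_norm_int_le => /eqP un.
have := lexx (N v%:F).
rewrite {2}(padic_norm_int v0) padic_norm_int_le => /eqP vn.
by rewrite padic_norm_int_le /= un vn addr0 mod0z.
Qed.

Lemma padic_nonarch : nonarch_norm N.
Proof.
split; [exact: padic_norm0|exact: padic_norm_gt0|exact: padic_normM|].
exact: padic_normD_le.
Qed.
Local Notation nna := padic_nonarch.

Lemma padic_norm_lt1 x : N x < 1 -> N x <= p%:R^-1.
Proof.
have [->|x0] := eqVneq x 0; first by rewrite padic_norm0 invr_ge0 ltW.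
rewrite padic_normE// -[ltRHS](expr0z p%:R) -exprN1 ltr_eXz2l// ler_eXz2l//.
Qed.

Lemma residue_nat n k : (n%:R : padic_int p_pr) k = (n%:Z %% (p ^ k)%N)%Z.
Proof.
by elim: n => [|n IHn] //; rewrite mulrSr /= IHn modzDm -PoszD addn1.
Qed.

Lemma padic_norm_nat n : coprime n p -> N n%:R = 1.
Proof.
move=> np; rewrite -(@rmorph_nat _ _ (@FracField.tofrac (padic_int p_pr))).
have n1 : (n%:R : padic_int p_pr) 1%N != 0.
  rewrite residue_nat expn1; apply/eqP => /dvdz_mod0P.
  rewrite dvdzE /= => pn; move: np; rewrite coprime_sym prime_coprime//.
  by rewrite pn.
have n0 : (n%:R : padic_int p_pr) != 0.
  by apply: contraNneq n1 => ->; rewrite /= mod0z.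
rewrite padic_norm_int// (@padic_int_ordP _ _ _ 0%N) ?expr0 ?invr1//.
by rewrite residue_nat expn0 modz1.
Qed.

(** Write [x] as [a / b] and cancel [p ^ k], the exact power in [b], from residues of [a] and [b].
    The cofactor [B] is then prime to [p], and [m] is [A] times its Bezout inverse. *)
Lemma padic_int_approx x n : N x <= 1 ->
  exists m : int, N (x - (padic_int_cst p_pr m)%:F) <= p%:R ^- n.
Proof.
have := frac_numden x; have := denom_ratioP (repr x).
move: (\n_(repr x)) (\d_(repr x)) => a b b0 -> Nx.
have Nb0 : 0 < N b%:F by rewrite padic_norm_gt0 tofrac_eq0.
set k := padic_int_ord b; have [bk bk1] := padic_int_ord_neq0 b0.
have ak : a k = 0.
  apply/eqP; rewrite -padic_norm_int_le -padic_norm_int//.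
  by move: Nx; rewrite (nrm_div nna) ler_pdivrMr// mul1r.
(* Division by [b] costs [k] digits; [n.+1] rather than [n] keeps [L > k] when [n = 0], which makes
   [B] prime to [p]. *)
set L := (k + n.+1)%N.
have /dvdz_mod0P/dvdzP[A aL] : (a L %% (p ^ k)%N)%Z = 0.
  by rewrite residue_le ?leq_addr.
have /dvdz_mod0P/dvdzP[B bL] : (b L %% (p ^ k)%N)%Z = 0.
  by rewrite residue_le ?leq_addr.
have : coprimez B (p ^ n.+1)%N.
  rewrite /coprimez /gcdz /= eqz_nat -/(coprime _ _) coprimeXr//.
  rewrite coprime_sym prime_coprime//; apply/negP => pB; move/eqP: bk1; apply.
  rewrite -(@residue_le _ _ b _ L); last by rewrite /L addnS ltnS leq_addr.
  apply/dvdz_mod0P; rewrite bL expnS PoszM dvdz_mul//.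
case/coprimezP => -[u v] /= uv; exists (A * u).
have -> : a%:F / b%:F - (padic_int_cst p_pr (A * u))%:F =
    (a - padic_int_cst p_pr (A * u) * b)%:F / b%:F.
  by rewrite tofracB tofracM mulrBl mulfK// tofrac_eq0.
rewrite (nrm_div nna) ler_pdivrMr// (padic_norm_int b0) -invfM -exprD.
apply: (@le_trans _ _ (p%:R ^- L)); last first.
  by rewrite lef_pV2 ?qualifE/= ?exprn_gt0// ler_eXn2l// /L -/k; lia.
rewrite padic_norm_int_le /= modzDmr -modzDmr modzNm modzDmr.
rewrite -modzDmr -modzNm modzMml modzNm modzDmr aL bL; apply/eqP/dvdz_mod0P.
have -> : A * (p ^ k)%N - A * u * (B * (p ^ k)%N) =
          A * v * (p ^ L)%N.
  have -> : (p ^ L)%N%:Z = (p ^ k)%N%:Z * (p ^ n.+1)%N%:Z.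
    by rewrite -PoszM -expnD.
  have : A * (p ^ k)%N = A * (p ^ k)%N * (u * B + v * (p ^ n.+1)%N).
    by rewrite uv mulr1.
  by move: (p ^ k)%N%:Z (p ^ n.+1)%N%:Z => P1 P2; lia.
by rewrite dvdz_mull.
Qed.

(** The differences [u n - u 0] are integral. Integers approximating them to within [p ^ - n] form a
    compatible sequence of residues, that is, a p-adic integer. *)
Lemma padic_complete (u : nat -> Qp) :
  (forall n, N (u n.+1 - u n) <= p%:R^-1 ^+ n) ->
  exists z, forall n, N (z - u n) <= p%:R^-1 ^+ n.
Proof.
have VX n : p%:R^-1 ^+ n = p%:R ^- n :> R by rewrite exprVn.
move=> u_cauchyV.
have u_cauchy n : N (u n.+1 - u n) <= p%:R ^- n by rewrite -VX.
have u_bounded n : N (u n - u 0%N) <= 1.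
  elim: n => [|n IHn]; first by rewrite subrr padic_norm0.
  rewrite -(subrK (u n) (u n.+1)) -addrA padic_normD_le//.
  by rewrite (le_trans (u_cauchy n))// invf_le1 ?exprn_gt0// exprn_ege1// ltW.
have /choice[m u_approx] : forall n, exists m : int,
    N (u n - u 0%N - (padic_int_cst p_pr m)%:F) <= p%:R ^- n.
  by move=> n; apply: padic_int_approx.
have m_compat n : (m n.+1 = m n %[mod (p ^ n)%N])%Z.
  suff : N (padic_int_cst p_pr (m n.+1) - padic_int_cst p_pr (m n))%:F
           <= p%:R ^- n.
    rewrite padic_norm_int_le /= modzDmr modzDml -modzDmr modzNm modzDmr.
    by move/eqP/dvdz_mod0P; rewrite -eqz_mod_dvd => /eqP.
  have -> : (padic_int_cst p_pr (m n.+1) - padic_int_cst p_pr (m n))%:F =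
     (u n - u 0%N - (padic_int_cst p_pr (m n))%:F) -
     (u n.+1 - u 0%N - (padic_int_cst p_pr (m n.+1))%:F) + (u n.+1 - u n).
    by rewrite tofracB; ring.
  rewrite padic_normD_le// (nrmB_le nna)//; apply: le_trans (u_approx _) _.
  by rewrite lef_pV2 ?qualifE/= ?exprn_gt0// ler_eXn2l.
exists ((padic_int_of p_pr m_compat)%:F + u 0%N) => n.
have -> : (padic_int_of p_pr m_compat)%:F + u 0%N - u n =
    (padic_int_of p_pr m_compat - padic_int_cst p_pr (m n))%:F -
    (u n - u 0%N - (padic_int_cst p_pr (m n))%:F).
  by rewrite tofracB; ring.
rewrite VX (nrmB_le nna)// padic_norm_int_le /=.
by rewrite modzDmr subrr mod0z.
Qed.

Lemma padic_dvf : complete_dvf N p%:R^-1.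
Proof.
split; [exact: nna| |exact: padic_norm_lt1|exact: padic_complete].
by rewrite invr_gt0 p_gt0 invf_lt1.
Qed.

End PadicNormTheory.

(** * The p-adic Potts-Bethe mapping *)

Lemma prod_XsubC_ord3 (F : fieldType) (y : 'I_3 -> F) :
  \prod_(i < 3) ('X - (y i)%:P) =
  ('X - (y 0)%:P) * ('X - (y 1)%:P) * ('X - (y 2)%:P).
Proof.
rewrite !big_ord_recl big_ord0 mulr1 mulrA.
by congr (_ * ('X - (y _)%:P) * ('X - (y _)%:P)); apply: val_inj.
Qed.

Section PadicPottsBethe.
Context (R : realType) (p : nat) (p_pr : prime p)
    (p_mod3 : (p = 1 %[mod 3])%N)
    (theta q : padic p_pr)
    (theta_neq1 : 0 < padic_norm R (theta - 1))
    (theta_lt_q2 : padic_norm R (theta - 1) < padic_norm R q ^+ 2)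
    (q2_lt1 : padic_norm R q ^+ 2 < 1)
    (y : 'I_3 -> padic p_pr)
    (y_roots : labelled_roots R theta q y).
Local Notation N := (@padic_norm p p_pr R).
Local Notation f := (potts_bethe theta q).
Local Notation a := (fixed_pt theta q y).
Local Notation r := (N (theta - 1) * N q).
Local Notation dvf := (padic_dvf R p_pr).
Implicit Types (x : padic p_pr) (u v : nat -> 'I_3).

Let N3 : N 3 = 1.
Proof.
apply: padic_norm_nat; rewrite prime_coprime//; apply/negP => /eqP.
by rewrite p_mod3.
Qed.

Let Ny0 : N (y 0) = 1. Proof. by case: y_roots. Qed.

Let Ny1 : N (y 1) = N q.
Proof.
case: y_roots => _ _ -> _ _.
exact: (norm_subs dvf theta_neq1 theta_lt_q2 q2_lt1).
Qed.

Let Ny2 : N (y 2) = N q.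
Proof.
case: y_roots => _ _ _ -> _.
exact: (norm_subs dvf theta_neq1 theta_lt_q2 q2_lt1).
Qed.

Let vieta : [/\ 1 + theta + theta ^+ 2 = y 0 + y 1 + y 2,
  (2 * theta + 1) * (1 - theta - q) = - (y 0 * y 1 + y 0 * y 2 + y 1 * y 2) &
  (1 - theta - q) ^+ 2 = y 0 * y 1 * y 2].
Proof.
apply: cubic_vieta; rewrite -prod_XsubC_ord3.
by case: y_roots.
Qed.

Let e1 : 1 + theta + theta ^+ 2 = y 0 + y 1 + y 2.
Proof. by case: vieta. Qed.
Let e2 : (2 * theta + 1) * (1 - theta - q)
  = - (y 0 * y 1 + y 0 * y 2 + y 1 * y 2).
Proof. by case: vieta. Qed.
Let e3 : (1 - theta - q) ^+ 2 = y 0 * y 1 * y 2.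
Proof. by case: vieta. Qed.

Definition codes u x := forall n, N (iter n f x - a (u n)) < r.

Lemma coding_domainP x :
  coding_domain R theta q y x <-> exists i, N (x - a i) < r.
Proof.
split=> [[i _ xi]|[i xi]]; exists i => //.
  by rewrite [r]mulrC.
by rewrite /padic_ball/= [ltRHS]mulrC.
Qed.

Lemma coding_domain_neq_pole x : coding_domain R theta q y x ->
  x != pole theta q.
Proof.
move/coding_domainP=> [i xi]; rewrite -subr_eq0.
exact: (ball_neq_pole dvf theta_neq1 theta_lt_q2 q2_lt1 Ny0 Ny1 Ny2 xi).
Qed.

(** The balls miss the pole, so an orbit that stays in them is defined at every time. *)
Lemma julia0P x : julia0 R theta q y x <->
  forall n, coding_domain R theta q y (iter n f x).
Proof.
split=> [Jx n|Jx n _]; first by case: (Jx n I).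
by split=> // k _; exact: coding_domain_neq_pole.
Qed.

Lemma julia0_codesP x : julia0 R theta q y x <-> exists u, codes u x.
Proof.
split=> [/julia0P Jx|[u ux]].
  have /choice[u ux] : forall n, exists i, N (iter n f x - a i) < r.
    by move=> n; apply/coding_domainP.
  by exists u.
by apply/julia0P => n; apply/coding_domainP; exists (u n).
Qed.

Lemma codes_fun u v x : codes u x -> codes v x -> u = v.
Proof.
move=> ux vx; apply/funext => n.
exact: (coding_ball_inj dvf N3 theta_neq1 theta_lt_q2 q2_lt1 e1 e2 e3
  Ny0 Ny1 Ny2 (ux n) (vx n)).
Qed.

Lemma codes_inj u x x' : codes u x -> codes u x' -> x = x'.
Proof.
exact: (coding_inj dvf N3 theta_neq1 theta_lt_q2 q2_lt1 e1 e2 e3 Ny0 Ny1 Ny2).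
Qed.

Lemma codes_ex u : exists x, codes u x.
Proof.
exact: (coding_surj dvf N3 theta_neq1 theta_lt_q2 q2_lt1 e1 e2 e3 Ny0 Ny1 Ny2).
Qed.

Lemma codes_shift u x : codes u x -> codes (shift u) (f x).
Proof. by move=> ux n; rewrite -iterSr; apply: ux. Qed.

Let q_neq0 : q != 0.
Proof.
apply/eqP => q0; move: (lt_trans theta_neq1 theta_lt_q2).
by rewrite q0 padic_norm0 expr0n ltxx.
Qed.

Let p_neq0 : p%:R != 0 :> R.
Proof. by rewrite pnatr_eq0 -lt0n prime_gt0. Qed.

(** The distance from [a i] to the pole is [N (theta - 1)] for [i = 0] and [r] otherwise, which
    gives the two values of [tau]. *)
Lemma expand_tau i : r / N (a i - pole theta q) ^+ 2 = p%:R ^ tau theta q i.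
Proof.
have := norm_fixed_pt_sub_pole dvf theta Ny0 Ny1 Ny2 i.
rewrite -/(fixed_pt theta q y i) -/(pole theta q) => ->.
have t_neq0 : theta - 1 != 0 by rewrite -(padic_norm_gt0 R).
rewrite (padic_normE R q_neq0) (padic_normE R t_neq0) /tau.
move: (padic_ord _) (padic_ord _) => m n.
have pm0 := expfz_neq0 m p_neq0; have pn0 := expfz_neq0 n p_neq0.
case: ifP => _; rewrite expfzDr// -!invr_expz.
  by move: (p%:R ^ m) (p%:R ^ n) pm0 pn0 => A B A0 B0; field; rewrite A0.
by move: (p%:R ^ m) (p%:R ^ n) pm0 pn0 => A B A0 B0; field; rewrite A0.
Qed.

Lemma shift_dist_codes u v x x' : codes u x -> codes v x' ->
  shift_dist R theta q y u v = N (x - x').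
Proof.
move=> ux vx; rewrite /shift_dist; case: pselect => [uv|uv]; last first.
  have uvE : u = v.
    by apply/funext => n; apply/eqP/negPn/negP => un; apply: uv; exists n.
  by rewrite uvE in ux; rewrite (codes_inj ux vx) subrr padic_norm0.
case: ex_minnP => n un n_min.
have eq_uv k : (k < n)%N -> u k = v k.
  by move=> kn; apply/eqP/negPn/negP => /n_min; rewrite leqNgt kn.
have := coding_dist dvf N3 theta_neq1 theta_lt_q2 q2_lt1 e1 e2 e3 Ny0 Ny1 Ny2
  ux vx eq_uv un.
have := norm_fixed_pt_sub dvf N3 theta_neq1 theta_lt_q2 q2_lt1 e1 e2 e3
  Ny0 Ny1 Ny2 un.
rewrite -/(a (u n)) -/(a (v n)) => /andP[+ _].
(* The two fixed points are distinct, so [kappa] really is the exponent of the norm of their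
   difference. *)
move=> /(lt_le_trans (mulr_gt0 theta_neq1 _)); rewrite !padic_norm_gt0.
move=> /(_ q_neq0) auv ->.
rewrite (padic_normE R auv) -/(kappa theta q y (u n) (v n)) expfzDr//.
congr (_ * _); rewrite -invr_expz; congr _^-1.
rewrite (big_morph (fun m : int => p%:R ^ m : R)
  (fun m m' => expfzDr m m' p_neq0) (expr0z _)).
by apply: eq_bigr => k _; rewrite expand_tau.
Qed.

(** After some [m] steps the orbit is within [N q] of 1, and from there its distance to 1 decays
    geometrically. *)
Lemma basin_of_not_julia0 x : (forall n, iter n f x != pole theta q) ->
  ~ julia0 R theta q y x -> basin R theta q 1 x.
Proof.
move=> x_pole xJ.
have [n|xJ'|m xm] := escape_to_basin dvf N3 theta_neq1 theta_lt_q2 q2_lt1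
  e1 e2 e3 Ny0 Ny1 Ny2 (x := x).
- by rewrite subr_eq0; exact: x_pole.
- by apply: xJ; apply/julia0P => n; apply/coding_domainP/xJ'.
split=> //; rewrite -(cvg_shiftn m).
have q_lt1 : `|N q| < 1.
  have Nq := nrm_ge0 dvf q.
  by rewrite ger0_norm// -(@expr_lt1 _ 2).
apply: (@squeeze_cvgr _ _ _ _ (fun=> 0)
    (fun n => N q ^+ n * N (iter m f x - 1))).
- near=> n => /=; rewrite iterD (nrm_ge0 dvf)/=.
  by have [] := potts_bethe_basin dvf N3 theta_neq1 theta_lt_q2 q2_lt1 n xm.
- exact: cvg_cst.
- rewrite -[X in _ --> X](mul0r (N (iter m f x - 1))).
  by apply: cvgM; [exact: cvg_expr|exact: cvg_cst].
Unshelve. all: by end_near. Qed.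

End PadicPottsBethe.

Theorem theorem4p9 (R : realType) (p : nat) (p_pr : prime p)
    (p_mod3 : (p = 1 %[mod 3])%N)
    (theta q : padic p_pr)
    (theta_exp : padic_exp_domain R theta)
    (theta_neq1 : 0 < padic_norm R (theta - 1))
    (theta_lt_q2 : padic_norm R (theta - 1) < padic_norm R q ^+ 2)
    (q2_lt1 : padic_norm R q ^+ 2 < 1)
    (y : 'I_3 -> padic p_pr)
    (y_roots : labelled_roots R theta q y) :
  isometrically_conjugate
    (julia0 R theta q y) (potts_bethe theta q)
    (fun x x' => padic_norm R (x - x'))
    [set: nat -> 'I_3] (@shift 'I_3) (shift_dist R theta q y)
  /\
  [set: padic p_pr] =
    basin R theta q 1 `|` julia0 R theta q y `|`
    \bigcup_(n : nat)
      iter_preimage (potts_bethe theta q) (pole theta q) n [set pole theta q].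
Proof.
have codesP := julia0_codesP theta_neq1 theta_lt_q2 q2_lt1 y_roots.
split.
  (* The conjugacy sends a point to its itinerary; off [julia0] it takes a constant default
     value. *)
  have /choice[h hP] : forall x, exists u,
      julia0 R theta q y x -> codes R theta q y u x.
    move=> x; have [/codesP[u ux]|xJ] := pselect (julia0 R theta q y x).
      by exists u.
    by exists (fun=> 0) => /xJ.
  split=> //.
    move=> x /codesP[u ux]; apply/codesP; exists (shift u).
    exact: codes_shift.
  exists h; split.
  - split=> //.
    + move=> x x'; rewrite !inE => Jx Jx' hxx'; have := hP _ Jx'.
      by rewrite -hxx'; apply: codes_inj (hP _ Jx).
    + move=> u _; have [x ux] := codes_ex p_mod3 theta_neq1 theta_lt_q2 q2_lt1
        y_roots u.
      have Jx : julia0 R theta q y x by apply/codesP; exists u.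
      by exists x => //; apply: codes_fun (hP _ Jx) ux.
  - move=> x x' Jx Jx'; apply: (shift_dist_codes p_mod3 theta_neq1 theta_lt_q2
      q2_lt1 y_roots); exact: hP.
  - move=> x Jx; have fx := codes_shift (hP _ Jx).
    have Jfx : julia0 R theta q y (potts_bethe theta q x).
      by apply/codesP; exists (shift (h x)).
    exact: (codes_fun p_mod3 theta_neq1 theta_lt_q2 q2_lt1 y_roots
      (hP _ Jfx) fx).
apply/esym/seteqP; split=> // x _.
have [Jx|nJx] := pselect (julia0 R theta q y x); first by left; right.
have [x_pole|/existsNP x_pole] := pselect (forall n,
    iter n (potts_bethe theta q) x != pole theta q).
  left; left.
  exact: (basin_of_not_julia0 p_mod3 theta_neq1 theta_lt_q2 q2_lt1 y_roots
    x_pole nJx).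
have {}x_pole : exists n, iter n (potts_bethe theta q) x == pole theta q.
  by case: x_pole => n /negP/negPn; exists n.
(* The first hitting time is taken because [iter_preimage] requires all earlier iterates to avoid
   the pole. *)
right; case: (ex_minnP x_pole) => n /eqP xn n_min; exists n => //; split=> //.
by move=> k kn; apply/negP => /n_min; rewrite leqNgt kn.
Qed.
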